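(* Let $t\in\{\mathrm{i},\mathrm{f}\}$, and let $\mathcal{P}_t^{\mathrm{N}},\mathcal{P}_t^{\mathrm{F}}$ be the outage probabilities of the near user and the far user as defined in the context. If $\alpha_{\mathrm{F}}\le\bar\gamma_t^{\mathrm{F}}\alpha_{\mathrm{N}}$, then $\mathcal{P}_t^{\mathrm{N}}=\mathcal{P}_t^{\mathrm{F}}=1$. If $\alpha_{\mathrm{F}}>\bar\gamma_t^{\mathrm{F}}\alpha_{\mathrm{N}}$, then $$\mathcal{P}_t^{\mathrm{N}}=\left(1-e^{-\chi_{t,1}\theta_t p^{-1}}\right)\left(1-e^{-\chi_{t,2}\theta_t p^{-1}}\right),\qquad \mathcal{P}_t^{\mathrm{F}}=1-e^{-\chi_{t,3}\vartheta_t p^{-1}},$$ where $\vartheta_t=\frac{\bar\gamma_t^{\mathrm{F}}}{\alpha_{\mathrm{F}}-\alpha_{\mathrm{N}}\bar\gamma_t^{\mathrm{F}}}$, $\theta_t=\max\left\{\frac{\bar\gamma_t^{\mathrm{N}}}{\alpha_{\mathrm{N}}},\vartheta_t\right\}$, and $\chi_{t,b}=\frac{\kappa_t\sigma_{\mathrm{c}}^2}{\mu_t\varrho_b}$ for $b\in\{1,2,3\}$ with $\varrho_3=\frac{\varrho_1\varrho_2}{\varrho_1+\varrho_2}$. Moreover, if $\alpha_{\mathrm{F}}>\bar\gamma_t^{\mathrm{F}}\alpha_{\mathrm{N}}$, then as $p\to\infty$ (all other parameters fixed), $$\mathcal{P}_t^{\mathrm{N}}\sim\chi_{t,1}\chi_{t,2}\theta_t^2p^{-2},\qquad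 \mathcal{P}_t^{\mathrm{F}}\sim\chi_{t,3}\vartheta_t p^{-1},$$ where $A\sim B$ means $A/B\to1$.
   Context: Two-user NOMA downlink. Let $h_1\sim\mathcal{CN}(0,\varrho_1)$ and $h_2\sim\mathcal{CN}(0,\varrho_2)$ be independent circularly symmetric complex Gaussian random variables with $\varrho_1,\varrho_2>0$. The near user (N) and far user (F) have channels with $|h_{\mathrm{N}}|=\max\{|h_1|,|h_2|\}$ and $|h_{\mathrm{F}}|=\min\{|h_1|,|h_2|\}$. Let $p>0$ be the power budget, $\sigma_{\mathrm{c}}^2>0$ the noise variance, and $\alpha_{\mathrm{N}},\alpha_{\mathrm{F}}>0$ power allocation factors with $\alpha_{\mathrm{N}}+\alpha_{\mathrm{F}}=1$ and $\alpha_{\mathrm{N}}<\alpha_{\mathrm{F}}$. The index $t=\mathrm{i}$ denotes integrated sensing and communications (ISAC), with $\kappa_{\mathrm{i}}=\mu_{\mathrm{i}}=1$; the index $t=\mathrm{f}$ denotes frequency-division sensing and communications (FDSAC), with $\kappa_{\mathrm{f}}=\kappa$ and $\mu_{\mathrm{f}}=\mu$, where $\kappa,\mu\in(0,1]$ are the fractions of bandwidth and power used for communications. Define $$\gamma_t^{\mathrm{sic}}=\frac{\mu_t p|h_{\mathrm{N}}|^2\alpha_{\mathrm{F}}}{\kappa_t\sigma_{\mathrm{c}}^2+\mu_t p|h_{\mathrm{N}}|^2\alpha_{\mathrm{N}}},\quad \gamma_t^{\mathrm{N}}=\frac{\mu_t p|h_{\mathrm{N}}|^2\alpha_{\mathrm{N}}}{\kappa_t\sigma_{\mathrm{c}}^2},\quad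 \gamma_t^{\mathrm{F}}=\frac{\mu_t p|h_{\mathrm{F}}|^2\alpha_{\mathrm{F}}}{\kappa_t\sigma_{\mathrm{c}}^2+\mu_t p|h_{\mathrm{F}}|^2\alpha_{\mathrm{N}}}.$$ Let $\overline{\mathcal{R}}_{\mathrm{N}},\overline{\mathcal{R}}_{\mathrm{F}}>0$ be target rates and set $\bar\gamma_t^{\mathrm{N}}=2^{\overline{\mathcal{R}}_{\mathrm{N}}/\kappa_t}-1$, $\bar\gamma_t^{\mathrm{F}}=2^{\overline{\mathcal{R}}_{\mathrm{F}}/\kappa_t}-1$. The outage probabilities are $$\mathcal{P}_t^{\mathrm{N}}=1-\Pr\left(\gamma_t^{\mathrm{sic}}>\bar\gamma_t^{\mathrm{F}},\ \gamma_t^{\mathrm{N}}>\bar\gamma_t^{\mathrm{N}}\right),\qquad \mathcal{P}_t^{\mathrm{F}}=\Pr\left(\gamma_t^{\mathrm{F}}<\bar\gamma_t^{\mathrm{F}}\right).$$ *)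

(* Defs.v *)
From HB Require Import structures.
From mathcomp Require Import all_boot all_order all_algebra.
From mathcomp Require Import all_classical all_reals all_analysis.
From mathcomp Require Import complex.

Set Implicit Arguments.
Unset Strict Implicit.
Unset Printing Implicit Defensive.

Import Order.TTheory GRing.Theory Num.Theory.
Import numFieldNormedType.Exports.

Local Open Scope classical_set_scope.
Local Open Scope ring_scope.

Section probability_notions.
Context {R : realType} {d : measure_display} {Omega : measurableType d}.
Variable P : probability Omega R.

(* Probability as a real number; [fine] loses nothing since [P A] is finite
   for measurable [A]. *)
Definition Pr (A : set Omega) : R := fine (P A).

Definition independent_rv (d1 d2 : measure_display)
    (T1 : measurableType d1) (T2 : measurableType d2)
    (X : Omega -> T1) (Y : Omega -> T2) : Prop :=
  forall (A : set T1) (B : set T2), measurable A -> measurable B ->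
    P (X @^-1` A `&` Y @^-1` B) = (P (X @^-1` A) * P (Y @^-1` B))%E.

(* [normal_prob] takes the standard deviation, not the variance. *)
Definition real_gaussian (v : R) (X : Omega -> R) : Prop :=
  measurable_fun setT X /\
  forall A : set R, measurable A ->
    P (X @^-1` A) = normal_prob 0 (Num.sqrt v) A.

(* CN(0, rho): real and imaginary parts are i.i.d. N(0, rho / 2), so that
   E|h|^2 = rho. *)
Definition circular_gaussian (rho : R) (h : Omega -> R[i]) : Prop :=
  [/\ real_gaussian (rho / 2) (fun w => complex.Re (h w)),
      real_gaussian (rho / 2) (fun w => complex.Im (h w)) &
      independent_rv (fun w => complex.Re (h w))
                     (fun w => complex.Im (h w))].

(* R[i] carries no measurable structure in the library: its Borel sets are
   those of the plane R * R. *)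
Definition independent_complex (h1 h2 : Omega -> R[i]) : Prop :=
  independent_rv
    (fun w => (complex.Re (h1 w), complex.Im (h1 w)))
    (fun w => (complex.Re (h2 w), complex.Im (h2 w))).

End probability_notions.

Inductive scheme := ISAC | FDSAC.

Section noma.
Context {R : realType}.

(* Fraction of the bandwidth (resp. power) used for communications by scheme
   [t], where [x] is the fraction used by FDSAC. *)
Definition comm_fraction (t : scheme) (x : R) : R :=
  match t with ISAC => 1 | FDSAC => x end.

Definition near_modulus (h1 h2 : R[i]) : R :=
  Num.max (Normc.normc h1) (Normc.normc h2).

Definition far_modulus (h1 h2 : R[i]) : R :=
  Num.min (Normc.normc h1) (Normc.normc h2).

(* Below, [k] and [m] are kappa_t and mu_t, [s2] is the noise variance, and
   [g] is a channel modulus. *)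
Definition sinr_sic (k m s2 aN aF p g : R) : R :=
  (m * p * g ^+ 2 * aF) / (k * s2 + m * p * g ^+ 2 * aN).

Definition snr_near (k m s2 aN p g : R) : R :=
  (m * p * g ^+ 2 * aN) / (k * s2).

Definition sinr_far (k m s2 aN aF p g : R) : R :=
  (m * p * g ^+ 2 * aF) / (k * s2 + m * p * g ^+ 2 * aN).

Definition sinr_target (k rate : R) : R := 2 `^ (rate / k) - 1.

Definition outage_near (d : measure_display) (Omega : measurableType d)
    (P : probability Omega R) (h1 h2 : Omega -> R[i])
    (k m s2 aN aF rN rF p : R) : R :=
  1 - Pr P [set w |
        sinr_sic k m s2 aN aF p (near_modulus (h1 w) (h2 w))
          > sinr_target k rF /\
        snr_near k m s2 aN p (near_modulus (h1 w) (h2 w))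
          > sinr_target k rN].

Definition outage_far (d : measure_display) (Omega : measurableType d)
    (P : probability Omega R) (h1 h2 : Omega -> R[i])
    (k m s2 aN aF rF p : R) : R :=
  Pr P [set w |
    sinr_far k m s2 aN aF p (far_modulus (h1 w) (h2 w)) < sinr_target k rF].

Definition vartheta (k aN aF rF : R) : R :=
  sinr_target k rF / (aF - aN * sinr_target k rF).

Definition theta (k aN aF rN rF : R) : R :=
  Num.max (sinr_target k rN / aN) (vartheta k aN aF rF).

Definition chi (k m s2 rho : R) : R := (k * s2) / (m * rho).

Definition asymp_equiv_pinfty (A B : R -> R) : Prop :=
  (fun p : R => A p / B p) @ +oo --> (1 : R).

End noma.

(* Main.v *)
(* If X, Y are independent N(0, rho/2), then |h|^2 = X^2 + Y^2 is exponential
   of mean rho. Without polar coordinates: for f >= 0, substituting y = |x| t,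
   exchanging the integrals and rescaling x by (1 + t^2)^(-1/2) gives
     int int f (x^2 + y^2) dx dy = K * int |x| f (x^2) dx,
   with K = int dt / (1 + t^2). The constant K is eliminated by normalizing, and
   the right-hand side is elementary for f u = 1_(u > r) exp (- u / rho).
   Each outage event compares max (|h1|^2, |h2|^2) or min (|h1|^2, |h2|^2) with a
   threshold, so independence yields the closed forms; the asymptotics follow
   from 1 / (1 + x) <= (1 - exp (- x)) / x <= 1. *)

Require Import Defs.
From HB Require Import structures.
From mathcomp Require Import all_boot all_order all_algebra.
From mathcomp Require Import all_classical all_reals all_analysis.
From mathcomp Require Import measurable_realfun complex ring lra.

Set Implicit Arguments.
Unset Strict Implicit.
Unset Printing Implicit Defensive.

Import Order.TTheory GRing.Theory Num.Theory.
Import numFieldNormedType.Exports.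

Local Open Scope classical_set_scope.
Local Open Scope ring_scope.

(** * Dilations of Lebesgue measure and reduction of radial integrals *)

Section integral_dilation.
Context {R : realType}.
Local Open Scope ereal_scope.
Local Notation mu := (@lebesgue_measure R).

(** Both sides are measures in [A] that agree on the intervals []a, b]], and Lebesgue measure is
    determined by its values there. *)
Lemma lebesgue_measure_dilation (c : R) (c0 : (0 < c)%R) (A : set R) :
  measurable A -> mu A = c%:E * mu ((fun x => c * x)%R @^-1` A).
Proof.
move=> mA.
have mc : measurable_fun [set: measurableTypeR R]
    ((fun x => c * x)%R : _ -> measurableTypeR R) by exact: measurable_funM.
pose c' := NngNum (ltW c0).
have := @lebesgue_measure_unique R (mscale c' (pushforward mu
  ((fun x => c * x)%R : measurableTypeR R -> measurableTypeR R))).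
apply => //= _ [[a b]] _ <-.
rewrite /mscale/= /pushforward.
rewrite [X in _ = _ * mu X](_ : _ = `](c^-1 * a)%R, (c^-1 * b)%R]%classic);
    last first.
  by apply/seteqP; split => x /=; rewrite !in_itv/= ltr_pdivrMl// ler_pdivlMl.
rewrite !lebesgue_measure_itv/= !lte_fin ltr_pM2l ?invr_gt0//.
case: ifPn => _; last by rewrite mule0.
by rewrite -!EFinB -EFinM -mulrBr mulVKf// gt_eqF.
Qed.

(** Obtained by pushing the measure forward rather than by differentiable substitution, so that [f]
    need only be measurable and may involve indicators. *)
Lemma ge0_integral_dilation (c : R) (f : R -> \bar R) : (0 < c)%R ->
  measurable_fun setT f -> (forall x, 0 <= f x) ->
  \int[mu]_x f x = c%:E * \int[mu]_x f (c * x)%R.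
Proof.
move=> c0 mf f0.
have mc : measurable_fun [set: measurableTypeR R]
    ((fun x => c * x)%R : _ -> measurableTypeR R) by exact: measurable_funM.
pose c' := NngNum (ltW c0).
(* This instance of [pushforward] as a measure cannot be inferred: its
   measurability argument occurs in no type. *)
pose nu := measure_function_pushforward__canonical__measure_function_Measure
  mu mc.
transitivity (\int[mscale c' nu]_x f x).
  by apply: eq_measure_integral => A mA _; exact: lebesgue_measure_dilation.
transitivity (c%:E * \int[nu]_x f x).
  by apply: (@ge0_integral_mscale _ _ _ _ _ _ c').
by congr (_ * _); exact: ge0_integral_pushforward.
Qed.

Lemma ge0_even_integralT (f : R -> \bar R) :
  measurable_fun setT f -> (forall x, 0 <= f x) -> (forall x, f (- x)%R = f x) ->
  \int[mu]_x f x = 2%:E * \int[mu]_(x in `[0%R, +oo[) f x.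
Proof.
move=> mf f0 ev.
rewrite -(setUv `]-oo, 0%R]%classic) setCitvl ge0_integral_setU//=; last 2 first.
  by rewrite -setCitvl setUv.
  by rewrite -setCitvl; exact/disj_setPCl.
rewrite integral_itv_obnd_cbnd; last exact: measurable_funTS.
rewrite mule_natl mule2n; congr (_ + _).
rewrite ge0_integration_by_substitution0//.
by apply: eq_integral => x _; rewrite ev.
Qed.

Lemma ge0_integral_radial (f : R -> \bar R) :
  measurable_fun setT f -> (forall x, 0 <= f x) ->
  \int[mu]_x \int[mu]_y f (x ^+ 2 + y ^+ 2)%R =
  (\int[mu]_t ((1 + t ^+ 2)^-1)%:E) * \int[mu]_x (`|x|%:E * f (x ^+ 2)%R).
Proof.
move=> mf f0.
have msq1 : measurable_fun setT (fun z : R * R => z.1 ^+ 2)%R.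
  exact: measurable_funX measurable_fst.
have msq2 : measurable_fun setT (fun z : R * R => z.2 ^+ 2)%R.
  exact: measurable_funX measurable_snd.
pose g (z : measurableTypeR R * measurableTypeR R) : \bar R :=
  `|z.1|%:E * f (z.1 ^+ 2 * (1 + z.2 ^+ 2))%R.
have mg : measurable_fun setT g.
  apply: emeasurable_funM.
    by apply/measurable_EFinP; exact: measurableT_comp.
  apply: measurableT_comp => //; apply: measurable_funM => //.
  exact: measurable_funD.
transitivity (\int[mu]_x \int[mu]_t g (x, t)).
  (* The substitution y = |x| t is available only for x != 0; the null point 0 is dropped from both
     outer integrals. *)
  rewrite -[LHS](@integral_setD1 _ _ 0%R); last 2 first.
  - exact: measurableD.
  - apply: measurable_funTS.
    apply: (measurable_fun_fubini_tonelli_F (m2 := mu)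
      (fun z : measurableTypeR R * measurableTypeR R =>
        f (z.1 ^+ 2 + z.2 ^+ 2)%R)) => //.
    by apply: measurableT_comp => //; exact: measurable_funD.
  rewrite -[RHS](@integral_setD1 _ _ 0%R); last 2 first.
  - exact: measurableD.
  - apply: measurable_funTS.
    apply: (measurable_fun_fubini_tonelli_F (m2 := mu) g) => // z.
    by rewrite mule_ge0.
  apply: eq_integral => x; rewrite inE/= => -[_ /eqP x0].
  have nx0 : (0 < `|x|)%R by rewrite normr_gt0.
  rewrite (ge0_integral_dilation nx0)//=; last first.
    apply: measurableT_comp => //; exact: measurable_funD.
  rewrite -ge0_integralZl//=; last first.
    apply: measurableT_comp => //; apply: measurable_funD => //.
    by apply: measurable_funX; exact: measurable_funM.
  apply: eq_integral => t _; rewrite /g/=; congr (_ * f _).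
  by rewrite exprMn real_normK ?num_real// mulrDr mulr1.
rewrite (fubini_tonelli (m1 := mu) (m2 := mu) g)//; last first.
  by move=> z; rewrite mule_ge0.
rewrite -ge0_integralZr//=; last 3 first.
- apply/measurable_EFinP; apply: continuous_measurable_fun => t.
  apply: cvgV; first by rewrite gt_eqF// ltr_wpDr// sqr_ge0.
  by apply: cvgD; [exact: cvg_cst|exact: sqr_continuous].
- by move=> t _; rewrite lee_fin invr_ge0 addr_ge0// sqr_ge0.
- by apply: integral_ge0 => x _; rewrite mule_ge0.
apply: eq_integral => t _; rewrite /g/=.
have t1 : (0 < 1 + t ^+ 2)%R by rewrite ltr_wpDr// sqr_ge0.
(* Chosen so that (c x)^2 (1 + t^2) = x^2. One factor [c] comes from the dilation and another from
   |c x|; together they give 1 / (1 + t^2). *)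
pose c := (Num.sqrt (1 + t ^+ 2))^-1%R.
have c0 : (0 < c)%R by rewrite invr_gt0 sqrtr_gt0.
have c2 : (c ^+ 2 = (1 + t ^+ 2)^-1)%R by rewrite exprVn sqr_sqrtr// ltW.
have mx2 : measurable_fun setT (fun x : R => x ^+ 2)%R.
  exact: measurable_funX.
have mnorm : measurable_fun setT (fun x : R => `|x|%:E).
  by apply/measurable_EFinP; exact: normr_measurable.
rewrite (ge0_integral_dilation c0); last 2 first.
- apply: emeasurable_funM => //; apply: measurableT_comp => //.
  exact: measurable_funM.
- by move=> x; rewrite mule_ge0.
rewrite -c2 expr2 EFinM -muleA; congr (_ * _).
rewrite -ge0_integralZl//; last 3 first.
- by apply: emeasurable_funM => //; exact: measurableT_comp.
- by move=> x _; rewrite mule_ge0.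
- by rewrite lee_fin ltW.
apply: eq_integral => x _; rewrite normrM (gtr0_norm c0) EFinM -muleA.
congr (_ * (_ * f _)).
by rewrite exprMn c2 mulrAC mulVf ?mul1r// gt_eqF.
Qed.

End integral_dilation.

(** * The sum of squares of two independent centred Gaussians *)

Section gaussian.
Context {R : realType}.
Local Open Scope ereal_scope.
Local Notation mu := (@lebesgue_measure R).

(** The Radon-Nikodym derivative and [normal_pdf] have the same integral over every measurable set,
    hence agree almost everywhere and are interchangeable as densities. *)
Lemma integral_normal_prob (m s : R) (f : R -> \bar R) :
  (normal_prob m s).-integrable setT f ->
  \int[normal_prob m s]_x f x = \int[mu]_x (f x * (normal_pdf m s x)%:E).
Proof.
move=> intf.
have dom := normal_prob_dominates m s.
have mf := measurable_int _ intf.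
rewrite -(Radon_Nikodym_change_of_variables dom)//.
apply: ae_eq_integral => //.
- by apply: emeasurable_funM => //; apply: measurable_int;
    apply: Radon_Nikodym_integrable.
- apply: emeasurable_funM => //.
  by apply/measurable_EFinP; exact: measurable_normal_pdf.
- apply: ae_eqe_mul2l; apply: integral_ae_eq => //.
  + exact: Radon_Nikodym_integrable.
  + by apply/measurable_EFinP; exact: measurable_normal_pdf.
  + by move=> E _ mE; rewrite -Radon_Nikodym_integral.
Qed.

(** The integrand has an elementary antiderivative vanishing at +oo; [0 <= s] keeps it nonnegative,
    as the improper fundamental theorem used here requires. *)
Lemma integral_mul_expR_sqr (rho s : R) : (0 < rho)%R -> (0 <= s)%R ->
  \int[mu]_(x in `[s, +oo[) (x * expR (- (x ^+ 2 / rho)))%:E =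
  (rho / 2 * expR (- (s ^+ 2 / rho)))%:E.
Proof.
move=> rho0 s0.
pose F x : R := (- (rho / 2) * expR (- (x ^+ 2 / rho)))%R.
have dF (x : R) : is_derive x 1%R F (x * expR (- (x ^+ 2 / rho)))%R.
  rewrite /F; apply: is_derive_eq; rewrite /GRing.scale/=.
  by field; rewrite gt_eqF.
have cF : continuous F.
  move=> x; apply: differentiable_continuous; apply/derivable1_diffP.
  exact: ex_derive.
rewrite (@ge0_continuous_FTC2y _ _ F s 0%R).
- by rewrite -EFinB sub0r /F mulNr opprK.
- by move=> x sx; rewrite mulr_ge0 ?expR_ge0// (le_trans s0).
- apply: continuous_subspaceT => x.
  apply: cvgM; first exact: cvg_id.
  apply: (@continuous_comp _ _ _ (fun x : R => - (x ^+ 2 / rho))%R expR);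
    last exact: continuous_expR.
  apply: cvgN; apply: cvgM; last exact: cvg_cst.
  exact: sqr_continuous.
- rewrite -[X in _ --> X](mulr0 (- (rho / 2))%R).
  apply: cvgM; first exact: cvg_cst.
  apply: (@cvg_comp _ _ _ (fun x : R => x ^+ 2 / rho)%R (fun x => expR (- x)) _
    (pinfty_nbhs R)); last exact: cvgr_expR.
  apply: gt0_cvgMly; first by rewrite invr_gt0.
  apply/cvgryPge => M; near=> x.
  (* From 1 <= x follows x <= x^2, so M <= x already gives M <= x^2. *)
  have x1 : (1 <= x)%R by near: x; apply: nbhs_pinfty_ge; rewrite num_real.
  have xM : (M <= x)%R by near: x; apply: nbhs_pinfty_ge; rewrite num_real.
  by rewrite (le_trans xM)// expr2 ler_peMl// (le_trans ler01).
- by move=> x _; case: (dF x).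
- by apply/cvg_at_right_filter; exact: cF.
- by move=> x _; rewrite derive1E; case: (dF x).
Unshelve. all: by end_near. Qed.

(** The joint density depends on (x, y) only through x^2 + y^2, and so does membership in the event;
    [ge0_integral_radial] therefore applies to their product. *)
Lemma normal_sqr_sum_prob (rho : R) (A : set R) : (0 < rho)%R -> measurable A ->
  let nu := normal_prob 0 (Num.sqrt (rho / 2)) in
  (nu \x nu) [set z : R * R | A (z.1 ^+ 2 + z.2 ^+ 2)%R] =
  \int[mu]_t (((1 + t ^+ 2)^-1)%:E) *
  \int[mu]_x (`|x|%:E * (normal_peak (Num.sqrt (rho / 2)) ^+ 2 *
                         (\1_A (x ^+ 2)%R * expR (- (x ^+ 2 / rho))))%:E).
Proof.
move=> rho0 mA nu.
pose F (u : R) := (normal_peak (Num.sqrt (rho / 2)) ^+ 2 *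
                   (\1_A u * expR (- (u / rho))))%:E.
have F0 u : 0 <= F u.
  by rewrite lee_fin mulr_ge0 ?sqr_ge0// mulr_ge0 ?expR_ge0.
have mF : measurable_fun setT F.
  apply/measurable_EFinP; apply: measurable_funM => //.
  apply: measurable_funM => //.
  apply: measurableT_comp => //.
  by apply: measurableT_comp => //; exact: measurable_funM.
rewrite -(ge0_integral_radial mF F0).
pose E := [set z : measurableTypeR R * measurableTypeR R |
  A (z.1 ^+ 2 + z.2 ^+ 2)%R].
have msq : measurable_fun setT
    (fun z : measurableTypeR R * measurableTypeR R => z.1 ^+ 2 + z.2 ^+ 2)%R.
  apply: measurable_funD.
    exact: measurable_funX measurable_fst.
  exact: measurable_funX measurable_snd.
have mE : measurable E by rewrite -[E]setTI; exact: msq.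
(* The integrability side condition holds because sections have probability at most 1 and [nu] has
   total mass 1. *)
rewrite /product_measure1 integral_normal_prob; last first.
  apply/integrableP; split; first exact: measurable_fun_xsection.
  apply: (@le_lt_trans _ _ (\int[nu]_x cst 1 x)).
    apply: ge0_le_integral => //=.
    - by apply: measurableT_comp => //; exact: measurable_fun_xsection.
    - move=> x _; rewrite gee0_abs// probability_le1//.
      exact: measurable_xsection.
  by rewrite integral_cst//= mul1e probability_setT ltry.
have s0 : Num.sqrt (rho / 2) != 0%R by rewrite gt_eqF// sqrtr_gt0 divr_gt0.
apply: eq_integral => x _ /=.
rewrite /nu /normal_prob integral_mkcond muleC -ge0_integralZl//=; last 3 first.
- apply/(measurable_restrictT _ (measurable_xsection x mE)).
  apply: measurable_funTS.
  by apply/measurable_EFinP; exact: measurable_normal_pdf.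
- by move=> y _; apply: erestrict_ge0 => t _; rewrite lee_fin normal_pdf_ge0.
- by rewrite lee_fin normal_pdf_ge0.
apply: eq_integral => y _; rewrite patchE /F indicE.
have -> : (y \in xsection E x) = ((x ^+ 2 + y ^+ 2)%R \in A).
  by apply/idP/idP; rewrite /xsection !inE/= ?inE.
case: ifPn => _; last by rewrite mule0 mul0r mulr0.
rewrite mul1r -EFinM; congr EFin.
rewrite /normal_pdf (negbTE s0) /normal_fun mulrACA -expr2 -expRD.
congr (_ * expR _)%R.
(* Twice the variance [rho / 2] is [rho], the common denominator of the two exponents. *)
rewrite sqr_sqrtr ?divr_ge0 ?ltW// !subr0 -mulr_natr divfK// !mulNr -opprD.
by rewrite -mulrDl.
Qed.

(** The flag [b] treats open and closed rays at once: the maximum of the squared moduli calls for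
    the open one, the minimum for the closed one. *)
Lemma normal_sqr_sum_tail (rho r : R) (b : bool) : (0 < rho)%R -> (0 <= r)%R ->
  let nu := normal_prob 0 (Num.sqrt (rho / 2)) in
  (nu \x nu) [set z : R * R |
    (z.1 ^+ 2 + z.2 ^+ 2)%R \in Interval (BSide b r) +oo%O] =
  (expR (- (r / rho)))%:E.
Proof.
move=> rho0 r0 nu.
set K := \int[mu]_t (((1 + t ^+ 2)^-1)%:E).
set c := (normal_peak (Num.sqrt (rho / 2)) ^+ 2)%R.
have c0 : (0 <= c)%R by exact: sqr_ge0.
have mexp : measurable_fun setT (fun x : R => expR (- (x ^+ 2 / rho))).
  apply: measurableT_comp => //; apply: measurableT_comp => //.
  by apply: measurable_funM => //; exact: measurable_funX.
(* Stated for a free ray because it is used twice: at the given one, and at [[0, +oo[] to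
   normalize. *)
have radial (b' : bool) (r' : R) : (0 <= r')%R ->
    (nu \x nu) [set z : R * R |
      (z.1 ^+ 2 + z.2 ^+ 2)%R \in Interval (BSide b' r') +oo%O] =
    K * (c * rho * expR (- (r' / rho)))%:E.
  move=> r'0.
  rewrite (normal_sqr_sum_prob (A := [set` Interval (BSide b' r') +oo%O]))//.
  congr (_ * _).
  rewrite ge0_even_integralT; last 3 first.
  - apply: emeasurable_funM.
      by apply/measurable_EFinP; exact: normr_measurable.
    apply/measurable_EFinP; apply: measurable_funM => //.
    apply: measurable_funM => //.
    apply: measurableT_comp => //; exact: measurable_funX.
  - by move=> x; rewrite mule_ge0// lee_fin mulr_ge0// mulr_ge0 ?expR_ge0.
  - by move=> x; rewrite normrN sqrrN.
  transitivity (2%:E * (c%:E *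
      \int[mu]_(x in [set` Interval (BSide b' (Num.sqrt r')) +oo%O])
        (x * expR (- (x ^+ 2 / rho)))%:E)).
    congr (_ * _).
    rewrite -ge0_integralZl//; last 2 first.
    - apply: measurable_funTS; apply/measurable_EFinP; exact: measurable_funM.
    - move=> x /=; rewrite in_itv/= andbT => /lteifW sx.
      by rewrite lee_fin mulr_ge0 ?expR_ge0// (le_trans _ sx)// sqrtr_ge0.
    rewrite [LHS]integral_mkcond [RHS]integral_mkcond.
    apply: eq_integral => x _.
    rewrite !patchE !mem_setE !in_itv/= !andbT indicE mem_setE in_itv/= andbT.
    (* For x < 0 both integrands vanish, since the ray starts at a square root; for x >= 0 the
       condition on x^2 becomes one on x. *)
    have [x0|x0] := leP 0%R x; last first.
      rewrite ifF//; apply/negbTE/negP => /lteifW; apply/negP.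
      by rewrite -ltNge (lt_le_trans x0)// sqrtr_ge0.
    have -> : (Num.sqrt r' < x ?<= if b')%R = (r' < x ^+ 2 ?<= if b')%R.
      by rewrite -{2}(sqr_sqrtr r'0); case: b' => /=;
        rewrite ?ler_pXn2r ?ltr_pXn2r// ?nnegrE ?sqrtr_ge0.
    rewrite ger0_norm//; case: ifPn => _; last by rewrite mul0r mulr0 mule0.
    by rewrite -!EFinM; congr EFin; rewrite mul1r mulrCA.
  have -> : \int[mu]_(x in [set` Interval (BSide b' (Num.sqrt r')) +oo%O])
      (x * expR (- (x ^+ 2 / rho)))%:E =
      (rho / 2 * expR (- (r' / rho)))%:E.
    rewrite -{2}(sqr_sqrtr r'0) -integral_mul_expR_sqr ?sqrtr_ge0//.
    (* The endpoint is a null set, so the open ray reduces to the closed one. *)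
    case: b' => //; rewrite integral_itv_obnd_cbnd//.
    apply: measurable_funTS; apply/measurable_EFinP; exact: measurable_funM.
  by rewrite -!EFinM; congr EFin; field.
(* The closed ray from 0 corresponds to the whole plane, of mass 1, which fixes the constant without
   evaluating [K]. *)
have Kc : K * (c * rho)%:E = 1.
  have := @radial true 0%R (lexx _).
  rewrite mul0r oppr0 expR0 mulr1 => <-.
  rewrite [X in (nu \x nu) X](_ : _ = setT `*` setT).
    have nuT : nu setT = 1 by exact: probability_setT.
    by rewrite product_measure1E//= -[RHS]mule1 -[in RHS]nuT.
  apply/seteqP; split => // z _ /=; rewrite in_itv/= andbT.
  by rewrite addr_ge0 ?sqr_ge0.
by rewrite radial// EFinM muleA Kc mul1e.
Qed.
End gaussian.

(** * Laws of the squared channel moduli, their maximum and their minimum *)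

Section complex_gaussian.
Context {R : realType} {d : measure_display} {Omega : measurableType d}.
Variable P : probability Omega R.

(** The outage events involve a modulus only through its square, and this polynomial form avoids the
    square root in [Normc.normc]. *)
Definition sqr_modulus (h : R[i]) : R := complex.Re h ^+ 2 + complex.Im h ^+ 2.

Lemma sqr_modulus_ge0 h : 0 <= sqr_modulus h.
Proof. by rewrite addr_ge0 ?sqr_ge0. Qed.

Lemma normc_sqr h : Normc.normc h ^+ 2 = sqr_modulus h.
Proof. by case: h => a b; rewrite sqr_sqrtr// addr_ge0 ?sqr_ge0. Qed.

Lemma near_modulus_sqr h1 h2 :
  near_modulus h1 h2 ^+ 2 = Num.max (sqr_modulus h1) (sqr_modulus h2).
Proof.
rewrite -!normc_sqr /near_modulus.
have n1 : 0 <= Normc.normc h1 by case: h1 => a b; exact: sqrtr_ge0.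
have n2 : 0 <= Normc.normc h2 by case: h2 => a b; exact: sqrtr_ge0.
by case: (leP (Normc.normc h1)) => h; [rewrite max_r|rewrite max_l];
  rewrite // ler_pXn2r// ltW.
Qed.

Lemma far_modulus_sqr h1 h2 :
  far_modulus h1 h2 ^+ 2 = Num.min (sqr_modulus h1) (sqr_modulus h2).
Proof.
rewrite -!normc_sqr /far_modulus.
have n1 : 0 <= Normc.normc h1 by case: h1 => a b; exact: sqrtr_ge0.
have n2 : 0 <= Normc.normc h2 by case: h2 => a b; exact: sqrtr_ge0.
by case: (leP (Normc.normc h1)) => h; [rewrite min_l|rewrite min_r];
  rewrite // ler_pXn2r// ltW.
Qed.

Lemma measurable_sqr_sum :
  measurable_fun setT (fun z : R * R => z.1 ^+ 2 + z.2 ^+ 2).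
Proof.
apply: measurable_funD.
  exact: measurable_funX measurable_fst.
exact: measurable_funX measurable_snd.
Qed.

Lemma circular_gaussian_measurable (rho : R) (h : Omega -> R[i]) :
  circular_gaussian P rho h ->
  measurable_fun setT (fun w => (complex.Re (h w), complex.Im (h w))).
Proof. by case=> -[mRe _] [mIm _] _; exact: measurable_fun_pair. Qed.

Lemma measurable_sqr_modulus (rho : R) (h : Omega -> R[i]) :
  circular_gaussian P rho h -> measurable_fun setT (sqr_modulus \o h).
Proof.
move=> /circular_gaussian_measurable mh.
exact: (measurableT_comp measurable_sqr_sum mh).
Qed.

(** Independence of the two parts makes their joint law agree with the product law on rectangles;
    uniqueness of the product measure extends this to the tail region. *)
Lemma circular_gaussian_tail (rho r : R) (b : bool) (h : Omega -> R[i]) :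
  0 < rho -> 0 <= r -> circular_gaussian P rho h ->
  P [set w | sqr_modulus (h w) \in Interval (BSide b r) +oo%O] =
  (expR (- (r / rho)))%:E.
Proof.
move=> rho0 r0 hg.
have mh : measurable_fun setT ((fun w => (complex.Re (h w), complex.Im (h w)))
    : Omega -> measurableTypeR R * measurableTypeR R).
  exact: circular_gaussian_measurable hg.
case: hg => -[_ Xl] [_ Yl] XY.
pose nu : probability (measurableTypeR R) R :=
  normal_prob 0 (Num.sqrt (rho / 2)).
pose m' := measure_function_pushforward__canonical__measure_function_Measure P mh.
rewrite -(normal_sqr_sum_tail b rho0 r0).
have mE : measurable [set z : measurableTypeR R * measurableTypeR R |
    z.1 ^+ 2 + z.2 ^+ 2 \in Interval (BSide b r) +oo%O].
  rewrite -[X in measurable X]setTI.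
  exact: (measurable_sqr_sum measurableT
    (measurable_itv (Interval (BSide b r) +oo%O))).
have nuE := @product_measure_unique _ _ _ _ _ nu nu m' _ _ mE.
symmetry; apply: nuE => A B mA mB.
by rewrite [LHS](XY A B mA mB) Xl// Yl.
Qed.

Lemma circular_gaussian_cdf (rho r : R) (h : Omega -> R[i]) :
  0 < rho -> 0 <= r -> circular_gaussian P rho h ->
  P [set w | sqr_modulus (h w) <= r] = (1 - expR (- (r / rho)))%:E.
Proof.
move=> rho0 r0 hg.
rewrite [X in P X](_ : _ = ~` [set w | sqr_modulus (h w) \in `]r, +oo[]);
    last first.
  apply/seteqP; split=> w /=; rewrite in_itv/= andbT leNgt; by move/negP.
rewrite probability_setC; last first.
  rewrite -[X in measurable X]setTI.
  exact: (measurable_sqr_modulus hg measurableT (measurable_itv `]r, +oo[)).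
by rewrite (circular_gaussian_tail _ rho0 r0 hg) EFinB.
Qed.

(** Each event is the preimage of a Borel set of the plane under the pair of real and imaginary
    parts. *)
Lemma independent_sqr_modulus (h1 h2 : Omega -> R[i]) (A B : set R) :
  independent_complex P h1 h2 -> measurable A -> measurable B ->
  P ([set w | A (sqr_modulus (h1 w))] `&` [set w | B (sqr_modulus (h2 w))]) =
  (P [set w | A (sqr_modulus (h1 w))] * P [set w | B (sqr_modulus (h2 w))])%E.
Proof.
move=> ind mA mB.
apply: (ind [set z | A (z.1 ^+ 2 + z.2 ^+ 2)] [set z | B (z.1 ^+ 2 + z.2 ^+ 2)]).
- by rewrite -[X in measurable X]setTI; exact: (measurable_sqr_sum measurableT mA).
- by rewrite -[X in measurable X]setTI; exact: (measurable_sqr_sum measurableT mB).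
Qed.

Section two_channels.
Variables (rho1 rho2 : R) (h1 h2 : Omega -> R[i]).
Hypotheses (rho1_gt0 : 0 < rho1) (rho2_gt0 : 0 < rho2).
Hypotheses (h1_gauss : circular_gaussian P rho1 h1)
  (h2_gauss : circular_gaussian P rho2 h2).
Hypothesis h12_indep : independent_complex P h1 h2.

(** In the complement both squared moduli are at most [r], so independence splits it into two
    distribution functions. *)
Lemma Pr_near_modulus_gt (r : R) : 0 <= r ->
  Pr P [set w | r < near_modulus (h1 w) (h2 w) ^+ 2] =
  1 - (1 - expR (- (r / rho1))) * (1 - expR (- (r / rho2))).
Proof.
move=> r0; rewrite /Pr.
have mE i : i = h1 \/ i = h2 -> measurable [set w | sqr_modulus (i w) <= r].
  have mr : measurable [set x : R | x <= r] by rewrite -set_itvNyc.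
  by move=> [] ->; rewrite -[X in measurable X]setTI;
    [exact: (measurable_sqr_modulus h1_gauss measurableT mr)
    |exact: (measurable_sqr_modulus h2_gauss measurableT mr)].
rewrite [X in P X](_ : _ = ~` ([set w | sqr_modulus (h1 w) <= r] `&`
    [set w | sqr_modulus (h2 w) <= r])); last first.
  apply/seteqP; split => w /=; rewrite near_modulus_sqr ltNge ge_max.
    by move=> /negP h [a b]; apply: h; rewrite a b.
  by move=> h; apply/negP => /andP.
rewrite probability_setC; last by apply: measurableI; apply: mE; [left|right].
rewrite (independent_sqr_modulus (A := [set x | x <= r]) (B := [set x | x <= r]))//;
  try by rewrite -set_itvNyc.
by rewrite (circular_gaussian_cdf rho1_gt0 r0 h1_gauss)
  (circular_gaussian_cdf rho2_gt0 r0 h2_gauss).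
Qed.

(** In the complement both squared moduli are at least [r], so it splits into two closed tails. *)
Lemma Pr_far_modulus_lt (r : R) : 0 <= r ->
  Pr P [set w | far_modulus (h1 w) (h2 w) ^+ 2 < r] =
  1 - expR (- (r / rho1)) * expR (- (r / rho2)).
Proof.
move=> r0; rewrite /Pr.
have mr : measurable [set` `[r, +oo[] by exact: measurable_itv.
rewrite [X in P X](_ : _ = ~` ([set w | sqr_modulus (h1 w) \in `[r, +oo[] `&`
    [set w | sqr_modulus (h2 w) \in `[r, +oo[])); last first.
  apply/seteqP; split => w /=;
    rewrite far_modulus_sqr ltNge le_min !in_itv/= !andbT.
    by move=> /negP h [a b]; apply: h; rewrite a b.
  by move=> h; apply/negP => /andP.
rewrite probability_setC; last first.
  by apply: measurableI; rewrite -[X in measurable X]setTI;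
    [exact: (measurable_sqr_modulus h1_gauss measurableT mr)
    |exact: (measurable_sqr_modulus h2_gauss measurableT mr)].
rewrite (independent_sqr_modulus (A := [set` `[r, +oo[]) (B := [set` `[r, +oo[]))//.
by rewrite (circular_gaussian_tail _ rho1_gt0 r0 h1_gauss)
  (circular_gaussian_tail _ rho2_gt0 r0 h2_gauss).
Qed.

End two_channels.
End complex_gaussian.

(** * Asymptotic equivalence at +oo *)

Section asymptotics.
Context {R : realType}.

Lemma one_sub_expRN_equiv (a : R) : 0 < a ->
  asymp_equiv_pinfty (fun p => 1 - expR (- (a * p^-1))) (fun p => a * p^-1).
Proof.
move=> a0; rewrite /asymp_equiv_pinfty.
apply: (@squeeze_cvgr _ _ _ _ (fun p : R => (1 + a * p^-1)^-1) (fun=> 1)).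
- near=> p.
  have p0 : 0 < p by near: p; apply: nbhs_pinfty_gt; rewrite num_real.
  set x := a * p^-1; have x0 : 0 < x by rewrite divr_gt0.
  have x1 : 0 < 1 + x by rewrite addr_gt0.
  apply/andP; split; last first.
    by rewrite ler_pdivrMr// mul1r lerBlDl -lerBlDr expR_ge1Dx.
  (* With a common denominator [x], the lower bound reduces to exp (- x) <= 1 / (1 + x), that is 1 +
     x <= exp x. *)
  have -> : (1 + x)^-1 = (1 - (1 + x)^-1) / x.
    by field; rewrite !gt_eqF.
  rewrite ler_pM2r ?invr_gt0// lerD2l lerN2 expRN lef_pV2 ?posrE ?expR_gt0//.
  exact: expR_ge1Dx.
- rewrite -[X in _ --> X]invr1; apply: cvgV; first exact: oner_neq0.
  rewrite -[X in _ --> X]addr0; apply: cvgD; first exact: cvg_cst.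
  rewrite -[X in _ --> X](mulr0 a); apply: cvgM; first exact: cvg_cst.
  apply/gtr0_cvgV0; last exact: cvg_id.
  by near=> p; near: p; apply: nbhs_pinfty_gt; rewrite num_real.
- exact: cvg_cst.
Unshelve. all: by end_near. Qed.

Lemma asymp_equiv_pinftyM (f f' g g' : R -> R) :
  asymp_equiv_pinfty f f' -> asymp_equiv_pinfty g g' ->
  asymp_equiv_pinfty (fun p => f p * g p) (fun p => f' p * g' p).
Proof.
rewrite /asymp_equiv_pinfty => ff gg.
rewrite (_ : (fun p => _) = (fun p => (f p / f' p) * (g p / g' p))).
  by rewrite -[X in _ --> X](mulr1 1); exact: cvgM.
(* As 0^-1 = 0, this identity holds at every [p], even where a denominator vanishes. *)
by apply/funext => p; rewrite invfM mulrACA.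
Qed.

(** A limit at +oo sees only positive arguments; this transfers equivalents through closed forms
    established for 0 < p. *)
Lemma asymp_equiv_pinfty_eq (f g h k : R -> R) :
  (forall p, 0 < p -> f p = g p) -> (forall p, 0 < p -> h p = k p) ->
  asymp_equiv_pinfty f h -> asymp_equiv_pinfty g k.
Proof.
move=> fg hk; apply: cvg_trans; apply: near_eq_cvg; near=> p.
have p0 : 0 < p by near: p; apply: nbhs_pinfty_gt; rewrite num_real.
by rewrite fg// hk.
Unshelve. all: by end_near. Qed.

End asymptotics.

(** * SINR conditions as thresholds on the squared modulus *)

Section sinr.
Context {R : realType}.

Lemma sinr_target_gt0 (k r : R) : 0 < k -> 0 < r -> 0 < sinr_target k r.
Proof.
move=> k0 r0; rewrite /sinr_target subr_gt0 /powR gt_eqF// -[ltLHS]expR0 ltr_expR.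
by rewrite mulr_gt0 ?divr_gt0// ln_gt0// ltr1n.
Qed.

(** Clearing denominators compares g N with q x (aF - aN g), whose last factor is positive. The
    first equality serves the far user, the second the near user's interference cancellation. *)
Lemma sinr_threshold (q N aN aF g x : R) : 0 < q -> 0 < N -> 0 < aN ->
  g * aN < aF -> 0 <= x ->
  (q * x * aF / (N + q * x * aN) < g) = (x < g / (aF - aN * g) * (N / q)) /\
  (g < q * x * aF / (N + q * x * aN)) = (g / (aF - aN * g) * (N / q) < x).
Proof.
move=> q0 N0 aN0 gaN x0.
have D0 : 0 < N + q * x * aN by rewrite ltr_wpDr// !mulr_ge0// ltW.
have E0 : 0 < q * (aF - aN * g) by rewrite mulr_gt0// subr_gt0 mulrC.
have -> : g / (aF - aN * g) * (N / q) = g * N / (q * (aF - aN * g)).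
  by field; move: E0; rewrite (gt_eqF q0) pmulr_rgt0// => /gt_eqF ->.
rewrite ltr_pdivrMr// ltr_pdivlMr// ltr_pdivlMr// ltr_pdivrMr//.
by split; apply/idP/idP; nra.
Qed.

(** Here q x aF <= g q x aN, and the noise term g N > 0 makes the inequality strict, even at x =
    0. *)
Lemma sinr_saturation (q N aN aF g x : R) : 0 < q -> 0 < N -> 0 < aN ->
  0 < g -> aF <= g * aN -> 0 <= x -> q * x * aF / (N + q * x * aN) < g.
Proof.
move=> q0 N0 aN0 g0 gaN x0.
have D0 : 0 < N + q * x * aN by rewrite ltr_wpDr// !mulr_ge0// ltW.
rewrite ltr_pdivrMr// mulrDr ltr_pwDl ?mulr_gt0//.
by rewrite mulrCA ler_wpM2l// mulr_ge0// ltW.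
Qed.
End sinr.
Theorem theorem1 (R : realType) (d : measure_display) (Omega : measurableType d)
    (P : probability Omega R) (h1 h2 : Omega -> R[i]) (rho1 rho2 : R)
    (rho1_gt0 : 0 < rho1) (rho2_gt0 : 0 < rho2)
    (h1_gauss : circular_gaussian P rho1 h1)
    (h2_gauss : circular_gaussian P rho2 h2)
    (h12_indep : independent_complex P h1 h2)
    (s2 aN aF : R) (s2_gt0 : 0 < s2)
    (aN_gt0 : 0 < aN) (aF_gt0 : 0 < aF) (aNF1 : aN + aF = 1) (aN_lt_aF : aN < aF)
    (kappa mu : R) (kappa_gt0 : 0 < kappa) (kappa_le1 : kappa <= 1)
    (mu_gt0 : 0 < mu) (mu_le1 : mu <= 1)
    (rN rF : R) (rN_gt0 : 0 < rN) (rF_gt0 : 0 < rF)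
    (t : scheme) :
  let k := comm_fraction t kappa in
  let m := comm_fraction t mu in
  let PN := fun p : R => outage_near P h1 h2 k m s2 aN aF rN rF p in
  let PF := fun p : R => outage_far P h1 h2 k m s2 aN aF rF p in
  let rho3 := rho1 * rho2 / (rho1 + rho2) in
  let chi1 := chi k m s2 rho1 in
  let chi2 := chi k m s2 rho2 in
  let chi3 := chi k m s2 rho3 in
  let th := theta k aN aF rN rF in
  let vth := vartheta k aN aF rF in
  [/\ forall p : R, 0 < p -> aF <= sinr_target k rF * aN ->
        PN p = 1 /\ PF p = 1,
      forall p : R, 0 < p -> sinr_target k rF * aN < aF ->
        PN p = (1 - expR (- (chi1 * th * p^-1))) *
               (1 - expR (- (chi2 * th * p^-1))) /\
        PF p = 1 - expR (- (chi3 * vth * p^-1))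
    & sinr_target k rF * aN < aF ->
        asymp_equiv_pinfty PN (fun p => chi1 * chi2 * th ^+ 2 * p ^- 2) /\
        asymp_equiv_pinfty PF (fun p => chi3 * vth * p^-1)].

Proof.
move=> k m PN PF rho3 chi1 chi2 chi3 th vth.
have k0 : 0 < k by rewrite /k; case: (t).
have m0 : 0 < m by rewrite /m; case: (t).
have gF0 : 0 < sinr_target k rF by exact: sinr_target_gt0.
have gN0 : 0 < sinr_target k rN by exact: sinr_target_gt0.
have N0 : 0 < k * s2 by exact: mulr_gt0.
have saturated p : 0 < p -> aF <= sinr_target k rF * aN -> PN p = 1 /\ PF p = 1.
  move=> p0 sat; have q0 : 0 < m * p by exact: mulr_gt0.
  split.
    (* Saturation rules out the cancellation condition at every sample point, so the success event
       is empty. *)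
    rewrite /PN /outage_near /Pr [X in P X](_ : _ = set0).
      by rewrite measure0 /= subr0.
    apply/seteqP; split => // w /= -[+ _].
    apply/negP; rewrite -leNgt ltW//.
    by apply: sinr_saturation => //; exact: sqr_ge0.
  rewrite /PF /outage_far /Pr [X in P X](_ : _ = setT).
    by rewrite probability_setT.
  apply/seteqP; split => // w _ /=.
  by apply: sinr_saturation => //; exact: sqr_ge0.
have closed_form p : 0 < p -> sinr_target k rF * aN < aF ->
    PN p = (1 - expR (- (chi1 * th * p^-1))) *
           (1 - expR (- (chi2 * th * p^-1))) /\
    PF p = 1 - expR (- (chi3 * vth * p^-1)).
  move=> p0 gaN; have q0 : 0 < m * p by exact: mulr_gt0.
  have vth0 : 0 < vth by rewrite divr_gt0// subr_gt0 mulrC.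
  have th0 : 0 < th by rewrite lt_max vth0 orbT.
  have r0 : 0 <= k * s2 / (m * p) by rewrite divr_ge0// ltW.
  (* Turns a squared-modulus threshold divided by the channel mean into the exponent of the closed
     form. *)
  have chiE rho x : 0 < rho ->
      x * (k * s2 / (m * p)) / rho = chi k m s2 rho * x * p^-1.
    by move=> rho0; rewrite /chi; field; rewrite !gt_eqF.
  split.
    rewrite /PN /outage_near.
    rewrite [X in Pr P X](_ : _ =
        [set w | th * (k * s2 / (m * p)) < near_modulus (h1 w) (h2 w) ^+ 2]).
      rewrite (Pr_near_modulus_gt rho1_gt0 rho2_gt0 h1_gauss h2_gauss h12_indep
        (mulr_ge0 (ltW th0) r0)).
      by rewrite !chiE// opprB addrC subrK.
    apply/predeqP => w /=.
    set x := near_modulus _ _ ^+ 2; have x0 : 0 <= x by exact: sqr_ge0.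
    have := (sinr_threshold q0 N0 aN_gt0 gaN x0).2.
    rewrite /sinr_sic -/x => ->.
    have -> : (sinr_target k rN <
          snr_near k m s2 aN p (near_modulus (h1 w) (h2 w))) =
        (sinr_target k rN / aN * (k * s2 / (m * p)) < x).
      rewrite /snr_near -/x ltr_pdivlMr//.
      have -> : sinr_target k rN / aN * (k * s2 / (m * p)) =
          sinr_target k rN * (k * s2) / (m * p * aN).
        by field; rewrite !gt_eqF.
      rewrite ltr_pdivrMr ?mulr_gt0//; congr (_ < _); ring.
    (* Both success conditions bound the same squared modulus from below, so the larger threshold
       decides; this is the maximum in [theta]. *)
    rewrite /th /theta maxr_pMl// gt_max.
    by split => [[a b]|/andP[]]; first apply/andP.
  rewrite /PF /outage_far.
  rewrite [X in Pr P X](_ : _ =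
      [set w | far_modulus (h1 w) (h2 w) ^+ 2 < vth * (k * s2 / (m * p))]).
    rewrite (Pr_far_modulus_lt rho1_gt0 rho2_gt0 h1_gauss h2_gauss h12_indep
      (mulr_ge0 (ltW vth0) r0)).
    (* The exponential rates add: 1 / rho1 + 1 / rho2 = 1 / rho3. *)
    rewrite -expRD -opprD; congr (1 - expR (- _)).
    rewrite /chi3 /rho3 /chi; field.
    by rewrite !gt_eqF// addr_gt0.
  apply/predeqP => w /=.
  set x := far_modulus _ _ ^+ 2; have x0 : 0 <= x by exact: sqr_ge0.
  by have := (sinr_threshold q0 N0 aN_gt0 gaN x0).1; rewrite /sinr_far -/x => ->.
split => // gaN.
have vth0 : 0 < vth by rewrite divr_gt0// subr_gt0 mulrC.
have th0 : 0 < th by rewrite lt_max vth0 orbT.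
have chi0 rho : 0 < rho -> 0 < chi k m s2 rho.
  by move=> rho0; rewrite divr_gt0// mulr_gt0.
split.
  (* Each factor of the closed form is equivalent to its exponent, of order 1 / p; the product gives
     order 1 / p^2. *)
  have := asymp_equiv_pinftyM
    (one_sub_expRN_equiv (mulr_gt0 (chi0 _ rho1_gt0) th0))
    (one_sub_expRN_equiv (mulr_gt0 (chi0 _ rho2_gt0) th0)).
  apply: asymp_equiv_pinfty_eq => p p0.
    by rewrite (closed_form p p0 gaN).1.
  by rewrite /chi1 /chi2; field; rewrite gt_eqF.
have rho30 : 0 < rho3 by rewrite divr_gt0 ?mulr_gt0 ?addr_gt0.
have := one_sub_expRN_equiv (mulr_gt0 (chi0 _ rho30) vth0).
by apply: asymp_equiv_pinfty_eq => p p0 //; rewrite (closed_form p p0 gaN).2.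
Qed.
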